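(* Let $A\in\mathbb{R}^{n\times n}$ be a primitive matrix with Perron root $\rho(A)$. Define a sequence of matrices by $A^{(0)}=A$ and, for $t=1,2,\dots$, $$A^{(t)}=D_{\mathbf{r}^{(t-1)}}^{-1}\,A^{(t-1)}\,D_{\mathbf{r}^{(t-1)}},$$ where $\mathbf{r}^{(t)}=(r_1^{(t)},\dots,r_n^{(t)})$ is the vector of row sums $r_i^{(t)}=\sum_{j=1}^n a^{(t)}_{ij}$ of $A^{(t)}=(a_{ij}^{(t)})$ and $D_{\mathbf{r}^{(t)}}$ is the diagonal matrix with diagonal entries $r_1^{(t)},\dots,r_n^{(t)}$. Then this iteration converges, in the sense that $$\lim_{t\to\infty}\min_{1\le i\le n} r_i^{(t)}=\rho(A)=\lim_{t\to\infty}\max_{1\le i\le n} r_i^{(t)}.$$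
   Context: A real matrix is positive (nonnegative) if all its entries are $>0$ ($\geq 0$). A nonnegative square matrix $A$ is primitive if $A^m$ is a positive matrix for some integer $m\geq 1$. The Perron root $\rho(A)$ of a primitive matrix $A$ is its spectral radius, which is a simple eigenvalue of $A$. A primitive matrix has no zero row, and a matrix of the form $D^{-1}AD$ with $D$ diagonal with positive diagonal entries is primitive when $A$ is, so all row sums $r_i^{(t)}$ are positive and the iteration is well defined. *)

(* Defs.v *)
From mathcomp Require Import all_boot all_order all_algebra.
From mathcomp Require Import all_classical all_reals all_analysis.
From mathcomp Require Import complex.

Set Implicit Arguments.
Unset Strict Implicit.
Unset Printing Implicit Defensive.

Import Order.TTheory GRing.Theory Num.Theory.
Import numFieldNormedType.Exports.

Local Open Scope classical_set_scope.
Local Open Scope ring_scope.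

Definition positive_mx (R : realType) (m n : nat) (A : 'M[R]_(m, n)) : Prop :=
  forall i j, 0 < A i j.

Definition nonneg_mx (R : realType) (m n : nat) (A : 'M[R]_(m, n)) : Prop :=
  forall i j, 0 <= A i j.

Definition primitive_mx (R : realType) (n : nat) (A : 'M[R]_n) : Prop :=
  nonneg_mx A /\ exists m : nat, (1 <= m)%N /\ positive_mx (A ^+ m).

(* The eigenvalues are the complex ones. For a nonempty matrix the set of
   moduli is finite and nonempty, so the supremum is a maximum. *)
Definition spectral_radius (R : realType) (n : nat) (A : 'M[R]_n) : R :=
  sup [set ComplexField.Normc.normc z | z in
        [set z : R[i]%C | eigenvalue (map_mx (real_complex R) A) z]].

Definition row_sums (R : realType) (n : nat) (A : 'M[R]_n) : 'rV[R]_n :=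
  \row_i \sum_j A i j.

Definition rowsum_step (R : realType) (n : nat) (A : 'M[R]_n) : 'M[R]_n :=
  invmx (diag_mx (row_sums A)) *m A *m diag_mx (row_sums A).

Definition rowsum_iter (R : realType) (n : nat) (A : 'M[R]_n) (t : nat) :
    'M[R]_n :=
  iter t (@rowsum_step R n) A.

(* The initial value of each fold below is itself an entry of the vector, so
   these are the minimum and maximum of the entries. *)
Definition min_entry (R : realType) (n : nat) (r : 'rV[R]_n.+1) : R :=
  \big[Num.min/r ord0 ord0]_(i < n.+1) r ord0 i.

Definition max_entry (R : realType) (n : nat) (r : 'rV[R]_n.+1) : R :=
  \big[Num.max/r ord0 ord0]_(i < n.+1) r ord0 i.

(* Main.v *)
Require Import Defs.
From mathcomp Require Import all_boot all_order all_algebra.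
From mathcomp Require Import all_classical all_reals all_analysis.
From mathcomp Require Import complex.
From mathcomp Require Import ring lra.

Set Implicit Arguments.
Unset Strict Implicit.
Unset Printing Implicit Defensive.

Import Order.TTheory GRing.Theory Num.Theory.
Import numFieldNormedType.Exports.

Local Open Scope classical_set_scope.
Local Open Scope ring_scope.

(** With u_t = A^t 1, the matrix A^(t) is the conjugate of A by diag(u_t), so
    r_i^(t) = (A u_t)_i / (u_t)_i and the iteration is the power method.  The
    minimal ratio increases and the maximal one decreases with t.  If B = A^k is
    positive, then (u_{t+k+1})_i / (u_{t+k})_i is an average of the ratios at
    time t whose weights are bounded below by some e > 0 for t >= k, whence
    e (max_t - min_t) <= min_{t+k} - min_t; the right-hand side tends to 0, so
    both extremes have a common limit l.  The modulus of any eigenvalue is at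
    most max_t, hence at most l, and l is itself an eigenvalue: otherwise
    u_t = (A - l)^-1 (A - l) u_t would be bounded by a multiple of
    (max_t - min_t) u_t. *)

Section NonnegativeMatrices.
Variable R : realType.

(** * Extreme entries and nonnegative matrices *)

Lemma min_entryP n (r : 'rV[R]_n.+1) (c : R) :
  reflect (forall i, c <= r ord0 i) (c <= min_entry r).
Proof.
apply: (iffP idP) => [cr i|cr].
- by apply: le_trans cr _; exact: bigmin_le.
- by apply: le_bigmin.
Qed.

Lemma max_entryP n (r : 'rV[R]_n.+1) (c : R) :
  reflect (forall i, r ord0 i <= c) (max_entry r <= c).
Proof.
apply: (iffP idP) => [cr i|cr].
- by apply: le_trans cr; exact: le_bigmax.
- by apply: bigmax_le.
Qed.

Lemma max_entry_attained n (r : 'rV[R]_n.+1) :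
  exists i, max_entry r = r ord0 i.
Proof.
rewrite /max_entry; apply: (big_ind (fun c => exists i, c = r ord0 i)).
- by exists ord0.
- by move=> _ _ [i ->] [j ->]; case: (leP (r ord0 i) (r ord0 j)); eauto.
- by move=> i _; exists i.
Qed.

Lemma ler_mulmx_cV m n (B : 'M[R]_(m, n)) (x y : 'cV[R]_n) :
  nonneg_mx B -> (forall j, x j ord0 <= y j ord0) ->
  forall i, (B *m x) i ord0 <= (B *m y) i ord0.
Proof.
by move=> B0 xy i; rewrite !mxE; apply: ler_sum => j _; exact: ler_wpM2l.
Qed.

(** A zero row of [A] would remain a zero row in every power A^m with m >= 1. *)
Lemma primitive_row_gt0 n (A : 'M[R]_n.+1) : primitive_mx A ->
  forall i, exists j, 0 < A i j.
Proof.
move=> [A0 [[|m] [m1 Am]]] i; first by [].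
have [Ai|noj] := pselect (exists j, 0 < A i j); first by [].
have := Am i ord0; rewrite exprS -mulmxE mxE big1 ?ltxx // => j _.
suff -> : A i j = 0 by rewrite mul0r.
apply/eqP; rewrite eq_le A0 andbT leNgt; apply/negP => Aij.
by apply: noj; exists j.
Qed.

(** * Power iterates and the closed form of the iteration *)

Definition power_iterate n (A : 'M[R]_n.+1) t : 'cV[R]_n.+1 :=
  A ^+ t *m const_mx 1.

Lemma power_iterateD n (A : 'M[R]_n.+1) s t :
  power_iterate A (s + t) = A ^+ s *m power_iterate A t.
Proof. by rewrite /power_iterate exprD -mulmxE mulmxA. Qed.

Lemma power_iterateS n (A : 'M[R]_n.+1) t :
  power_iterate A t.+1 = A *m power_iterate A t.
Proof. exact: (power_iterateD A 1 t). Qed.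

Lemma power_iterate_gt0 n (A : 'M[R]_n.+1) t : primitive_mx A ->
  forall i, 0 < power_iterate A t i ord0.
Proof.
move=> hA; elim: t => [|t IH] i.
  by rewrite /power_iterate expr0 mul1mx mxE ltr01.
have [j Aij] := primitive_row_gt0 hA i; have [A0 _] := hA.
rewrite power_iterateS mxE (bigD1 j) //= ltr_pwDl ?mulr_gt0 //.
by apply: sumr_ge0 => l _; rewrite mulr_ge0 ?A0 // ltW.
Qed.

Lemma invmx_diag n (d : 'rV[R]_n) : (forall i, d ord0 i != 0) ->
  invmx (diag_mx d) = diag_mx (\row_i (d ord0 i)^-1).
Proof.
move=> d0; have E : diag_mx (\row_i (d ord0 i)^-1) *m diag_mx d = 1%:M.
  apply/matrixP => i j; rewrite mul_diag_mx !mxE.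
  by case: eqVneq => [->|]; rewrite ?mulr1n ?mulVf // mulr0.
have [_ U] := mulmx1_unit E.
by rewrite -[LHS]mul1mx -E -mulmxA mulmxV // mulmx1.
Qed.

Lemma row_sums_conj n (A : 'M[R]_n.+1) (u : 'cV[R]_n.+1) i :
  row_sums (\matrix_(i, j) ((u i ord0)^-1 * A i j * u j ord0)) ord0 i =
  (A *m u) i ord0 / u i ord0.
Proof.
rewrite !mxE mulr_suml; apply: eq_bigr => j _.
by rewrite mxE -mulrA mulrC.
Qed.

(** The conjugations telescope: the row sums at time t are the quotients of the entries of u_{t+1}
    by those of u_t, so conjugating by them turns diag(u_t) into diag(u_{t+1}). *)
Lemma rowsum_iterE n (A : 'M[R]_n.+1) t : primitive_mx A ->
  rowsum_iter A t = \matrix_(i, j)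
    ((power_iterate A t i ord0)^-1 * A i j * power_iterate A t j ord0).
Proof.
move=> hA; elim: t => [|t IH].
  apply/matrixP => i j.
  by rewrite /power_iterate expr0 mul1mx !mxE invr1 mul1r mulr1.
have u0 i := lt0r_neq0 (power_iterate_gt0 t hA i).
have v0 i := lt0r_neq0 (power_iterate_gt0 t.+1 hA i).
rewrite /rowsum_iter iterS -/(rowsum_iter A t) /rowsum_step.
have rE i : row_sums (rowsum_iter A t) ord0 i =
    power_iterate A t.+1 i ord0 / power_iterate A t i ord0.
  by rewrite IH row_sums_conj power_iterateS.
move: (row_sums _) rE => r rE; rewrite IH invmx_diag => [|i]; last first.
  by rewrite rE mulf_neq0 ?invr_eq0.
apply/matrixP => i j; rewrite mul_mx_diag mxE mul_diag_mx mxE.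
rewrite [(\row__ _) _ _]mxE [(\matrix_(_, _) _) _ _]mxE !rE [RHS]mxE.
by field; rewrite !u0 v0.
Qed.

Lemma row_sums_iterE n (A : 'M[R]_n.+1) t i : primitive_mx A ->
  row_sums (rowsum_iter A t) ord0 i =
  power_iterate A t.+1 i ord0 / power_iterate A t i ord0.
Proof. by move=> hA; rewrite rowsum_iterE // row_sums_conj power_iterateS. Qed.

(** * Positive matrices: comparable entries and contraction *)

Lemma positive_mx_entry_ratio n (B : 'M[R]_n.+1) : positive_mx B ->
  exists2 C, 0 < C & forall i j k l, B i j <= C * B k l.
Proof.
(* Every entry is at most [S] and every inverse entry at most [T], so B_ij <= S <= S T B_kl. *)
move=> B0; pose S := \sum_i \sum_j B i j; pose T := \sum_i \sum_j (B i j)^-1.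
have entry_le (F : 'I_n.+1 -> 'I_n.+1 -> R) i j :
    (forall i j, 0 < F i j) -> F i j <= \sum_i \sum_j F i j.
  move=> F0; rewrite (bigD1 i) //= (bigD1 j) //= -addrA lerDl.
  by rewrite addr_ge0 ?sumr_ge0 // => k _; rewrite ?sumr_ge0 // => *; exact: ltW.
have leS i j : B i j <= S by apply: entry_le.
have leT i j : (B i j)^-1 <= T.
  by apply: (entry_le (fun i j => (B i j)^-1)) => k l; rewrite invr_gt0.
have S0 : 0 < S by apply: lt_le_trans (leS ord0 ord0).
have T0 : 0 < T by apply: lt_le_trans (leT ord0 ord0); rewrite invr_gt0.
exists (S * T) => [|i j k l]; first exact: mulr_gt0.
apply: le_trans (leS i j) _; rewrite -mulrA ler_pMr //.
by rewrite -ler_pdivrMr // mul1r.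
Qed.

Lemma positive_mulmx_entry_ratio n (B : 'M[R]_n.+1) C (z : 'cV[R]_n.+1) :
  (forall i j k l, B i j <= C * B k l) -> (forall i, 0 <= z i ord0) ->
  forall i j, (B *m z) i ord0 <= C * (B *m z) j ord0.
Proof.
move=> BC z0 i j; rewrite !mxE mulr_sumr; apply: ler_sum => l _.
by rewrite mulrA ler_wpM2r.
Qed.

(** The vector x - m y is nonnegative with j-th entry (M - m) y_j, and [B] spreads this single
    excess over all entries. *)
Lemma positive_mulmx_contraction n (B : 'M[R]_n.+1) C (x y : 'cV[R]_n.+1) m M j :
  positive_mx B -> 0 < C -> (forall i j k l, B i j <= C * B k l) ->
  (forall i, 0 < y i ord0) -> (forall i j, y i ord0 <= C * y j ord0) ->
  (forall i, m * y i ord0 <= x i ord0) -> x j ord0 = M * y j ord0 ->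
  forall i, (m + (n.+1%:R * C ^+ 2)^-1 * (M - m)) * (B *m y) i ord0 <=
    (B *m x) i ord0.
Proof.
move=> B0 C0 BC y0 yC mx xj i; set K := _ * C ^+ 2.
have K0 : 0 < K by rewrite mulr_gt0 ?ltr0n ?exprn_gt0.
have mM : m <= M by rewrite -(ler_pM2r (y0 j)) -xj.
(* Each of the n+1 terms B_il y_l is at most C^2 B_ij y_j. *)
have By : (B *m y) i ord0 <= K * (B i j * y j ord0).
  have -> : K * (B i j * y j ord0) = \sum_(l < n.+1) C ^+ 2 * (B i j * y j ord0).
    by rewrite sumr_const card_ord /K -mulrA mulr_natl.
  rewrite mxE.
  apply: ler_sum => l _; rewrite expr2 mulrACA.
  by apply: ler_pM; rewrite ?(ltW (B0 _ _)) ?(ltW (y0 _)).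
(* Only the j-th term of (B (x - m y))_i is kept; the others are nonnegative. *)
have gap : B i j * ((M - m) * y j ord0) <= (B *m x) i ord0 - m * (B *m y) i ord0.
  rewrite !mxE mulr_sumr -sumrB (bigD1 j) //= xj.
  rewrite [leLHS](_ : _ = B i j * (M * y j ord0) - m * (B i j * y j ord0));
    last by ring.
  rewrite lerDl.
  apply: sumr_ge0 => l _; rewrite mulrCA -mulrBr mulr_ge0 ?subr_ge0 //.
  exact/ltW/B0.
rewrite mulrDl -lerBrDl; apply: le_trans gap.
rewrite -mulrA ler_pdivrMl //.
rewrite [leRHS](_ : _ = (K * (B i j * y j ord0)) * (M - m)); last by ring.
by rewrite mulrC; apply: ler_wpM2r; rewrite ?subr_ge0.
Qed.

(** [eigenvalue] provides a row vector with v A = z v. Its entrywise moduli [w], paired with [u],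
    give |z| w u <= w A u <= c w u, where w u > 0. *)
Lemma normc_le_of_eigenvalue n (A : 'M[R]_n.+1) (u : 'cV[R]_n.+1) c z :
  nonneg_mx A -> (forall i, 0 < u i ord0) ->
  (forall i, (A *m u) i ord0 <= c * u i ord0) ->
  eigenvalue (map_mx (real_complex R) A) z -> ComplexField.Normc.normc z <= c.
Proof.
move=> A0 u0 Au /eigenvalueP[v vA v0].
pose w i := ComplexField.Normc.normc (v ord0 i).
have normE (x : R[i]%C) : `|x| = (ComplexField.Normc.normc x)%:C%C.
  by rewrite normc_def; case: x.
have w0 i : 0 <= w i by rewrite /w; case: (v _ _) => a b; exact: sqrtr_ge0.
have wA j : ComplexField.Normc.normc z * w j <= \sum_i w i * A i j.
  rewrite -ComplexField.Normc.normcM -lecR -normE.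
  have -> : z * v ord0 j = (z *: v) ord0 j by rewrite mxE.
  rewrite -vA mxE rmorph_sum; apply: le_trans (ler_norm_sum _ _ _) _.
  apply: ler_sum => i _; rewrite mxE normrM rmorphM /= !normE.
  suff -> : ComplexField.Normc.normc (A i j)%:C%C = A i j by [].
  by rewrite /= expr0n /= addr0 sqrtr_sqr ger0_norm.
have S0 : 0 < \sum_i w i * u i ord0.
  have /rV0Pn[k vk] := v0.
  rewrite (bigD1 k) //= ltr_pwDl //.
    rewrite mulr_gt0 // lt0r w0 andbT.
    by apply: contra vk => /eqP/ComplexField.Normc.eq0_normc ->.
  by apply: sumr_ge0 => i _; rewrite mulr_ge0 // ltW.
rewrite -(ler_pM2r S0) !mulr_sumr.
apply: (@le_trans _ _ (\sum_j \sum_i w i * A i j * u j ord0)).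
  by apply: ler_sum => j _; rewrite mulrA -mulr_suml ler_pM2r.
rewrite exchange_big /=; apply: ler_sum => i _.
under eq_bigr do rewrite -mulrA.
rewrite -mulr_sumr mulrCA; apply: ler_wpM2l => //.
by have := Au i; rewrite mxE.
Qed.

(** * Monotonicity of the extreme row sums *)

Section PowerMethod.
Variables (n : nat) (A : 'M[R]_n.+1).
Hypothesis hA : primitive_mx A.

Let u t i : R := power_iterate A t i ord0.
Let lo t := min_entry (row_sums (rowsum_iter A t)).
Let hi t := max_entry (row_sums (rowsum_iter A t)).

Let u_gt0 t i : 0 < u t i. Proof. exact: power_iterate_gt0. Qed.
Let A_ge0 : nonneg_mx A. Proof. by case: hA. Qed.

Lemma le_min_rowsumP c t :
  reflect (forall i, c * u t i <= u t.+1 i) (c <= lo t).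
Proof.
apply: (iffP (min_entryP _ _)) => H i; move: (H i);
  by rewrite row_sums_iterE // ler_pdivlMr //; exact: u_gt0.
Qed.

Lemma max_rowsum_leP c t :
  reflect (forall i, u t.+1 i <= c * u t i) (hi t <= c).
Proof.
apply: (iffP (max_entryP _ _)) => H i; move: (H i);
  by rewrite row_sums_iterE // ler_pdivrMr //; exact: u_gt0.
Qed.

(** Applying the nonnegative [A] to lo_t u_t <= u_{t+1} gives lo_t u_{t+1} <= u_{t+2}. *)
Lemma min_rowsum_nondecreasing : {homo lo : s t / (s <= t)%N >-> s <= t}.
Proof.
apply: homo_leq => [//|? ? ?|t]; first exact: le_trans.
apply/le_min_rowsumP => i; have /le_min_rowsumP H := lexx (lo t).
rewrite /u power_iterateS [in leRHS]power_iterateS.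
have := @ler_mulmx_cV _ _ A (lo t *: power_iterate A t) (power_iterate A t.+1).
rewrite -scalemxAr => /(_ A_ge0)/(_ _ i); rewrite mxE; apply=> j.
by rewrite mxE; exact: H.
Qed.

Lemma max_rowsum_nonincreasing : {homo hi : s t / (s <= t)%N >-> t <= s}.
Proof.
apply: homo_leq => [//|a b c ba cb|t]; first exact: le_trans cb ba.
apply/max_rowsum_leP => i; have /max_rowsum_leP H := lexx (hi t).
rewrite /u power_iterateS [in leRHS]power_iterateS.
have := @ler_mulmx_cV _ _ A (power_iterate A t.+1) (hi t *: power_iterate A t).
rewrite -scalemxAr => /(_ A_ge0)/(_ _ i); rewrite [leRHS]mxE; apply=> j.
by rewrite [leRHS]mxE; exact: H.
Qed.

Lemma min_rowsum_le_max t : lo t <= hi t.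
Proof.
have /le_min_rowsumP H := lexx (lo t); have /max_rowsum_leP H' := lexx (hi t).
by rewrite -(ler_pM2r (u_gt0 t ord0)) (le_trans (H _)).
Qed.

Lemma rowsum_gap_le : exists k, exists2 e, 0 < e &
  forall t, (k <= t)%N -> e * (hi t - lo t) <= lo (t + k)%N - lo t.
Proof.
have [_ [k [_ Ak]]] := hA; have [C C0 AC] := positive_mx_entry_ratio Ak.
exists k; exists (n.+1%:R * C ^+ 2)^-1 => [|t kt].
  by rewrite invr_gt0 mulr_gt0 ?ltr0n ?exprn_gt0.
rewrite lerBrDl; apply/le_min_rowsumP => i.
(* Here t >= k is used: u_t = A^k u_{t-k} lies in the image of the positive matrix A^k, so [C] does
   not depend on t. *)
have uC a b : u t a <= C * u t b.
  rewrite /u -(subnKC kt) power_iterateD.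
  by apply: positive_mulmx_entry_ratio => // l; exact/ltW/u_gt0.
have [j hij] := max_entry_attained (row_sums (rowsum_iter A t)).
(* The contraction is applied to B = A^k, y = u_t and x = u_{t+1}, with [j] a row of maximal sum. *)
rewrite /u addnC -addnS !power_iterateD.
apply: (@positive_mulmx_contraction _ _ C _ _ _ _ j) => //.
- exact: u_gt0.
- by apply/le_min_rowsumP.
- by rewrite /hi hij row_sums_iterE // divfK // gt_eqF // u_gt0.
Qed.

(** * Convergence to a common limit *)

Lemma min_rowsum_cvg : cvgn lo.
Proof.
apply: nondecreasing_is_cvgn; first exact: min_rowsum_nondecreasing.
exists (hi 0) => _ [t _ <-]; apply: le_trans (min_rowsum_le_max t) _.
exact: max_rowsum_nonincreasing.
Qed.

Lemma rowsum_gap_cvg0 : (hi t - lo t) @[t --> \oo] --> 0.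
Proof.
have [k [e e0 gap]] := rowsum_gap_le.
(* This upper bound for the gap vanishes because [lo] and its shift by k have the same limit. *)
have cv : (e^-1 * (lo (t + k)%N - lo t)) @[t --> \oo] --> 0.
  rewrite -(mulr0 e^-1) -(subrr (limn lo)).
  apply: cvgMr; apply: cvgB; last exact: min_rowsum_cvg.
  by rewrite cvg_shiftn; exact: min_rowsum_cvg.
apply: squeeze_cvgr (cvg_cst 0) cv; near=> t.
rewrite subr_ge0 min_rowsum_le_max ler_pdivlMl // gap //.
by near: t; exact: nbhs_infty_ge.
Unshelve. all: by end_near. Qed.

Lemma max_rowsum_cvg : hi @ \oo --> limn lo.
Proof.
have -> : hi = (fun t => (hi t - lo t) + lo t) by apply/funext => t; rewrite subrK.
rewrite -[X in _ --> X]add0r.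
by apply: cvgD; [exact: rowsum_gap_cvg0|exact: min_rowsum_cvg].
Qed.

Lemma min_rowsum_le_lim t : lo t <= limn lo.
Proof.
exact: (nondecreasing_cvgn_le min_rowsum_nondecreasing min_rowsum_cvg).
Qed.

Lemma lim_le_max_rowsum t : limn lo <= hi t.
Proof.
rewrite -(cvg_lim _ max_rowsum_cvg) //.
apply: (nonincreasing_cvgn_ge max_rowsum_nonincreasing).
by apply/cvg_ex; eexists; exact: max_rowsum_cvg.
Qed.

(** * Identification of the limit with the spectral radius *)

Lemma rowsum_lim_eigenvalue : eigenvalue A (limn lo).
Proof.
rewrite /eigenvalue /eigenspace kermx_eq0 row_free_unit; apply/negP => U.
set B := A - (limn lo)%:M in U *.
pose K : R := \sum_i \sum_j `|invmx B i j|.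
(* Both u_{t+1} and l u_t, with l the limit, lie entrywise between lo_t u_t and hi_t u_t. *)
have Bu t j : `|(B *m power_iterate A t) j ord0| <= (hi t - lo t) * u t j.
  have -> : (B *m power_iterate A t) j ord0 = u t.+1 j - limn lo * u t j.
    rewrite mulmxBl mul_scalar_mx -power_iterateS /u.
    by move: (power_iterate A t.+1) (power_iterate A t) => x y; rewrite !mxE.
  have /le_min_rowsumP/(_ j) lou := lexx (lo t).
  have /max_rowsum_leP/(_ j) uhi := lexx (hi t).
  have lol := ler_wpM2r (ltW (u_gt0 t j)) (min_rowsum_le_lim t).
  have lhi := ler_wpM2r (ltW (u_gt0 t j)) (lim_le_max_rowsum t).
  by rewrite mulrBl ler_norml; apply/andP; split; lra.
have Ku t i : u t i <= (\sum_j `|invmx B i j|) * (hi t - lo t) * \sum_j u t j.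
  have -> : u t i = (invmx B *m (B *m power_iterate A t)) i ord0.
    by rewrite mulmxA mulVmx // mul1mx.
  apply: le_trans (ler_norm _) _; rewrite mxE -mulrA mulr_suml.
  apply: le_trans (ler_norm_sum _ _ _) _; apply: ler_sum => j _.
  rewrite normrM; apply: ler_wpM2l => //; apply: le_trans (Bu t j) _.
  apply: ler_wpM2l; first by rewrite subr_ge0 min_rowsum_le_max.
  by rewrite [leRHS](bigD1 j) //= lerDl sumr_ge0 // => k _; exact/ltW/u_gt0.
(* Summing [Ku] over i and cancelling the positive sum of u_t leaves a bound whose constant [K] is
   free of t, contradicting the vanishing gap. *)
have K1 t : 1 <= K * (hi t - lo t).
  have S0 : 0 < \sum_j u t j.
    rewrite (bigD1 ord0) //= ltr_pwDl ?u_gt0 // sumr_ge0 // => k _.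
    exact/ltW/u_gt0.
  rewrite -(ler_pM2r S0) mul1r /K !mulr_suml; exact: ler_sum.
have cv : (K * (hi t - lo t)) @[t --> \oo] --> 0.
  by rewrite -(mulr0 K); apply: cvgMr; exact: rowsum_gap_cvg0.
have : 1 <= (0 : R).
  rewrite -(cvg_lim _ cv) //; apply: limr_ge; last exact: nearW.
  by apply/cvg_ex; eexists; exact: cv.
by rewrite ler10.
Qed.

Lemma spectral_radius_rowsum_lim : spectral_radius A = limn lo.
Proof.
set E := [set ComplexField.Normc.normc z | z in
  [set z : R[i]%C | eigenvalue (map_mx (real_complex R) A) z]].
have ub : ubound E (limn lo).
  move=> _ [z zA <-]; rewrite -(cvg_lim _ max_rowsum_cvg) //.
  apply: limr_ge; first by apply/cvg_ex; eexists; exact: max_rowsum_cvg.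
  apply: nearW => t.
  apply: (normc_le_of_eigenvalue A_ge0 (u_gt0 t) _ zA) => i.
  by rewrite -power_iterateS; apply/max_rowsum_leP.
(* The limit is at least lo_0 >= 0, so it is its own modulus as a complex eigenvalue; being also an
   upper bound of [E], it is the supremum. *)
have El : E (limn lo).
  exists (real_complex R (limn lo)); last first.
    rewrite /= expr0n /= addr0 sqrtr_sqr ger0_norm //.
    apply: le_trans (min_rowsum_le_lim 0); apply/le_min_rowsumP => i.
    by rewrite mul0r; exact/ltW/u_gt0.
  by rewrite /= eigenvalue_map rowsum_lim_eigenvalue.
apply/eqP; rewrite eq_le; apply/andP; split.
- by apply: ge_sup => //; exists (limn lo).
- by apply: ub_le_sup => //; exists (limn lo).
Qed.

End PowerMethod.
End NonnegativeMatrices.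

Theorem theorem2p2 (R : realType) (n : nat) (A : 'M[R]_n.+1)
    (hA : primitive_mx A) :
  ((fun t : nat => min_entry (row_sums (rowsum_iter A t))) @ \oo
     --> spectral_radius A) /\
  ((fun t : nat => max_entry (row_sums (rowsum_iter A t))) @ \oo
     --> spectral_radius A).
Proof.
rewrite (spectral_radius_rowsum_lim hA).
by split; [exact: min_rowsum_cvg|exact: max_rowsum_cvg].
Qed.
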